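(* Let $\mathfrak g$ be an untwisted affine Kac--Moody Lie algebra and let $\lambda\in\mathcal P^+$ be a regular dominant integral weight with $\langle\lambda,d\rangle=0$. Then the vertices of the dominant weight polyhedron $D_\lambda$ are contained in the set $\{\hat b_J(\lambda)\}_{J\subsetneq I}$, where $J$ ranges over all proper subsets of $I$ (including $\varnothing$).
   Context: $\mathfrak g$ is the untwisted affine Kac--Moody Lie algebra (conventions of Kac's book) of a finite-dimensional simple complex Lie algebra of rank $l$, with Cartan subalgebra $\mathfrak h$, derivation $d\in\mathfrak h$, $I=\{0,1,\dots,l\}$, simple roots $\alpha_i$, simple coroots $\alpha_i^\vee$, simple reflections $s_i$ generating the Weyl group $W$, basic imaginary root $\delta$. $\mathcal P^+=\{\lambda\in\mathfrak h^*:\langle\lambda,\alpha_i^\vee\rangle\in\mathbb Z_{\ge0}\ \forall i\in I\}$; $\lambda$ is regular dominant if $\langle\lambda,\alpha_i^\vee\rangle>0$ for all $i\in I$. Fundamental weights: $\langle\Lambda_i,\alpha_j^\vee\rangle=\delta_{ij}$, $\langle\Lambda_i,d\rangle=0$. $\mathfrak h^*_{\mathbb Q}=\bigoplus_{i\in I}\mathbb Q\Lambda_i\oplus\mathbb Q\delta$, and $\mathcal C_{\mathbb Q}=\{\mu\in\mathfrak h^*_{\mathbb Q}:\langle\mu,\alpha_i^\vee\rangle\ge0\ \forall i\in I\}$. Dominant weight polyhedron: $D_\lambda=\mathcal C_{\mathbb Q}\cap\operatorname{conv}_{\mathbb Q}\{w\lambda:w\in W\}$, where $\operatorname{conv}_{\mathbb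 Q}$ is the rational convex hull. It is a rational polyhedron; its vertices are its zero-dimensional faces. For $J\subsetneq I$, $W_J=\langle s_j:j\in J\rangle\subset W$ (a finite group) and $\hat b_J(\lambda)=\frac1{|W_J|}\sum_{w\in W_J}w(\lambda)$. *)

(* Defs.v *)
From HB Require Import structures.
From mathcomp Require Import all_boot all_order all_algebra.
From mathcomp Require Import finmap.
From mathcomp Require Import boolp classical_sets cardinality reals.
From mathcomp Require Import complex.
Set Implicit Arguments.
Unset Strict Implicit.
Unset Printing Implicit Defensive.
Import Order.TTheory GRing.Theory Num.Theory.
Local Open Scope classical_set_scope.
Local Open Scope ring_scope.

(* Convention throughout: A i j = <alpha_j, alpha_i^vee>, as in Kac's book. *)

Section FiniteType.
Variable l : nat.
Implicit Types A : 'M[int]_l.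

Definition positive_definite_symmetrizable A : Prop :=
  exists d : 'rV[rat]_l,
    let S := diag_mx d *m map_mx intr A in
    [/\ forall i, 0 < d 0 i,
        S^T = S &
        forall x : 'rV[rat]_l, x != 0 -> 0 < (x *m S *m x^T) 0 0].

Definition indecomposable A : Prop :=
  forall S : {set 'I_l},
    (forall i j, i \in S -> j \notin S -> A i j = 0 /\ A j i = 0) ->
    S = finset.set0 \/ S = finset.setT.

(* The Cartan matrices of the finite-dimensional simple complex Lie algebras
   of rank l. *)
Definition simple_cartan_matrix A : Prop :=
  [/\ (0 < l)%N,
      forall i, A i i = 2,
      forall i j, i != j -> A i j <= 0 /\ (A i j = 0 -> A j i = 0),
      positive_definite_symmetrizable A &
      indecomposable A].

(* [root_coroot A b g]: b is the vector of coefficients, on the simple roots,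
   of a root beta = w(alpha_i), and g is the vector of coefficients, on the
   simple coroots, of the coroot beta^vee = w(alpha_i^vee), with w in the Weyl
   group of A. *)
Inductive root_coroot A : 'rV[int]_l -> 'rV[int]_l -> Prop :=
| RootCorootSimple i : root_coroot A (delta_mx 0 i) (delta_mx 0 i)
| RootCorootRefl i b g : root_coroot A b g ->
    root_coroot A (b - (b *m A^T) 0 i *: delta_mx 0 i)
                  (g - (g *m A) 0 i *: delta_mx 0 i).

Definition highest_root_coroot A (theta thetav : 'rV[int]_l) : Prop :=
  root_coroot A theta thetav /\
  forall b g, root_coroot A b g -> forall i, b 0 i <= theta 0 i.

(* The index 0 of the extended matrix stands for alpha_0 = delta - theta and
   alpha_0^vee = c - theta^vee, c being the canonical central element. *)
Definition extended_cartan_matrix A (theta thetav : 'rV[int]_l)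
    : 'M[int]_(1 + l) :=
  block_mx 2%:M                (- (thetav *m A))
           (- (A *m theta^T))  A.

End FiniteType.

Definition untwisted_affine (l : nat) (A : 'M[int]_l.+1) : Prop :=
  exists (A0 : 'M[int]_l) (theta thetav : 'rV[int]_l),
    [/\ simple_cartan_matrix A0,
        highest_root_coroot A0 theta thetav &
        A = extended_cartan_matrix A0 theta thetav].

Section Weights.
Variables (K : numFieldType) (l : nat).

(* The realization of A: the Cartan subalgebra h has basis
   alpha_0^vee, ..., alpha_l^vee, d, and its dual h^* is given the dual basis,
   which is Lambda_0, ..., Lambda_l, delta. *)
Definition cartan : Type := 'cV[K]_l.+2.
Definition weight : Type := 'rV[K]_l.+2.

Definition pairing (mu : weight) (h : cartan) : K := (mu *m h) 0 0.

Definition coroot (i : 'I_l.+1) : cartan := delta_mx (lift ord_max i) 0.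
Definition scaling : cartan := delta_mx ord_max 0.

Definition fundamental_weight (i : 'I_l.+1) : weight :=
  delta_mx 0 (lift ord_max i).
Definition delta_root : weight := delta_mx 0 ord_max.

Variable A : 'M[int]_l.+1.

(* <alpha_j, alpha_i^vee> = A i j, <alpha_0, d> = 1 and <alpha_j, d> = 0 for
   j != 0. *)
Definition simple_root (j : 'I_l.+1) : weight :=
  \sum_i (A i j)%:~R *: fundamental_weight i + (j == ord0)%:R *: delta_root.

(* Matrices act on weights on the right: this is the matrix of
   mu |-> mu - <mu, alpha_i^vee> alpha_i. *)
Definition simple_reflection (i : 'I_l.+1) : 'M[K]_l.+2 :=
  1%:M - coroot i *m simple_root i.

(* The group generated by the s_j, j in J; products of generators suffice, as
   the s_j are involutions. *)
Inductive weyl (J : {set 'I_l.+1}) : set 'M[K]_l.+2 :=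
| Weyl1 : weyl J 1%:M
| WeylM j w : j \in J -> weyl J w -> weyl J (simple_reflection j *m w).

Definition integral_dominant (lam : weight) : Prop :=
  forall i, exists n : nat, pairing lam (coroot i) = n%:R.

Definition regular_dominant (lam : weight) : Prop :=
  forall i, 0 < pairing lam (coroot i).

Definition rational_weights : set weight :=
  [set mu | exists (q : 'I_l.+1 -> rat) (r : rat),
     mu = \sum_i ratr (q i) *: fundamental_weight i + ratr r *: delta_root].

Definition dominant_chamberQ : set weight :=
  [set mu | rational_weights mu /\ forall i, 0 <= pairing mu (coroot i)].

Definition convQ (S : set weight) : set weight :=
  [set mu | exists (n : nat) (q : 'I_n -> rat) (v : 'I_n -> weight),
     [/\ forall k, 0 <= q k,
         \sum_k q k = 1,
         forall k, S (v k) &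
         mu = \sum_k ratr (q k) *: v k]].

Definition weyl_orbit (lam : weight) : set weight :=
  [set lam *m w | w in weyl finset.setT].

Definition dominant_polyhedron (lam : weight) : set weight :=
  dominant_chamberQ `&` convQ (weyl_orbit lam).

(* Faces of a polyhedron P of rational weights, cut out by valid inequalities;
   the linear functionals on rational weights are the pairings with the
   rational elements of h. *)
Definition face (P F : set weight) : Prop :=
  exists (a : 'cV[rat]_l.+2) (c : rat),
    (forall mu, P mu -> pairing mu (map_mx ratr a) <= ratr c) /\
    F = P `&` [set mu | pairing mu (map_mx ratr a) = ratr c].

Definition vertices (P : set weight) : set weight := [set mu | face P [set mu]].

(* [fset_set] is meaningful on finite sets only; weyl J is finite when J is a
   proper subset. *)
Definition bhat (J : {set 'I_l.+1}) (lam : weight) : weight :=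
  (#|` fset_set (weyl J)|)%:R^-1 *: \sum_(w <- fset_set (weyl J)) lam *m w.

End Weights.

Arguments coroot {K l} i.
Arguments scaling {K l}.
Arguments fundamental_weight {K l} i.
Arguments delta_root {K l}.

(* Main.v *)
(* Points of D_lam are written lam - sum_i c_i alpha_i. They satisfy c >= 0,
   because w lam <= lam for every w; this follows from the fact that every real
   root is positive or negative, together with the deletion argument for words.

   Conversely, let c >= 0 be supported on a proper subset J and let
   mu = lam - sum_j c_j alpha_j be J-dominant. Then mu lies in the convex hull
   of the orbit, by induction on |J|: starting from the W_J-invariant point
   bhat_J(lam), the line through mu either leaves the cone below lam at a point
   supported on a smaller set, or mu = bhat_J(lam) since A_J is positive
   definite.

   Let mu be a vertex and J the support of c. If J <> I, the segment from
   bhat_J(lam) to mu can be prolonged inside D_lam, so mu = bhat_J(lam). If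
   J = I, then mu + s delta lies in D_lam for some s > 0, so a functional whose
   maximum on D_lam is attained at mu only is negative on delta. But D_lam
   contains points b - n k delta with k > 0 and n arbitrarily large (reflect
   b = bhat_{I - 0}(lam) by s_0 and average again over W_{I - 0}), on which this
   functional is unbounded. *)

Require Import Defs.
From mathcomp Require Import all_boot all_order all_algebra.
From mathcomp Require Import finmap.
From mathcomp Require Import boolp classical_sets cardinality reals.
From mathcomp Require Import complex.
From mathcomp Require Import ring lra zify.
Set Implicit Arguments.
Unset Strict Implicit.
Unset Printing Implicit Defensive.
Import Order.TTheory GRing.Theory Num.Theory.
Local Open Scope classical_set_scope.
Local Open Scope ring_scope.

(** * Bilinear forms over the rationals *)

Definition bform n (S : 'M[rat]_n) (x y : 'rV[rat]_n) : rat :=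
  (x *m S *m y^T) 0 0.

Section BilinearForm.
Variables (n : nat) (S : 'M[rat]_n).
Implicit Types x y z : 'rV[rat]_n.

Lemma bformDl x y z : bform S (x + y) z = bform S x z + bform S y z.
Proof. by rewrite /bform !mulmxDl mxE. Qed.

Lemma bformDr x y z : bform S x (y + z) = bform S x y + bform S x z.
Proof. by rewrite /bform linearD /= mulmxDr mxE. Qed.

Lemma bformZl t x y : bform S (t *: x) y = t * bform S x y.
Proof. by rewrite /bform -!scalemxAl mxE. Qed.

Lemma bformZr t x y : bform S x (t *: y) = t * bform S x y.
Proof. by rewrite /bform linearZ /= -scalemxAr mxE. Qed.

Lemma bformNl x y : bform S (- x) y = - bform S x y.
Proof. by rewrite -scaleN1r bformZl mulN1r. Qed.

Lemma bformNr x y : bform S x (- y) = - bform S x y.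
Proof. by rewrite -scaleN1r bformZr mulN1r. Qed.

Lemma bform_sumE x y : bform S x y = \sum_i \sum_j x 0 i * S i j * y 0 j.
Proof.
rewrite /bform mxE exchange_big /=; apply: eq_bigr => j _.
by rewrite !mxE mulr_suml.
Qed.

Lemma bformC : S^T = S -> forall x y, bform S x y = bform S y x.
Proof.
move=> symS x y; rewrite !bform_sumE exchange_big /=.
by apply: eq_bigr => i _; apply: eq_bigr => j _; rewrite -{1}symS mxE; ring.
Qed.

End BilinearForm.

(** * Symmetrized Cartan matrices and lengths of roots *)

Definition symmetrized n (d : 'rV[rat]_n) (A : 'M[int]_n) : 'M[rat]_n :=
  diag_mx d *m map_mx intr A.

(* Coordinate i is the pairing of the root lattice vector x with the i-th
   simple coroot. *)
Definition coroot_values n (A : 'M[int]_n) (x : 'rV[rat]_n) : 'rV[rat]_n :=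
  x *m (map_mx intr A)^T.

Section Symmetrizable.
Variables (n : nat) (A : 'M[int]_n) (d : 'rV[rat]_n).
Local Notation S := (symmetrized d A).
Implicit Types x y : 'rV[rat]_n.

Lemma symmetrizedE i j : S i j = d 0 i * (A i j)%:~R.
Proof. by rewrite /symmetrized mul_diag_mx !mxE. Qed.

Lemma coroot_valuesE x i : coroot_values A x 0 i = \sum_j (A i j)%:~R * x 0 j.
Proof. by rewrite mxE; apply: eq_bigr => j _; rewrite !mxE mulrC. Qed.

Lemma coroot_valuesD x y :
  coroot_values A (x + y) = coroot_values A x + coroot_values A y.
Proof. exact: mulmxDl. Qed.

Lemma coroot_valuesB x y :
  coroot_values A (x - y) = coroot_values A x - coroot_values A y.
Proof. exact: mulmxBl. Qed.

Lemma coroot_valuesZ t x : coroot_values A (t *: x) = t *: coroot_values A x.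
Proof. by rewrite /coroot_values -scalemxAl. Qed.

Lemma bform_values x y :
  bform S x y = \sum_i x 0 i * d 0 i * coroot_values A y 0 i.
Proof.
rewrite bform_sumE; apply: eq_bigr => i _.
rewrite coroot_valuesE mulr_sumr; apply: eq_bigr => j _.
by rewrite symmetrizedE; ring.
Qed.

Lemma bform_delta i y :
  bform S (delta_mx 0 i) y = d 0 i * coroot_values A y 0 i.
Proof.
rewrite bform_values (bigD1 i) //= big1 ?addr0 => [|j ji].
  by rewrite mxE !eqxx mul1r.
by rewrite mxE eqxx (negbTE ji) !mul0r.
Qed.

Hypothesis diagA : forall i, A i i = 2.
Hypothesis d_gt0 : forall i, 0 < d 0 i.
Hypothesis symS : S^T = S.

Lemma symmetrized_entries i j : d 0 i * (A i j)%:~R = d 0 j * (A j i)%:~R.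
Proof. by rewrite -!symmetrizedE -{1}symS mxE. Qed.

Lemma coroot_values_delta i : coroot_values A (delta_mx 0 i) 0 i = 2.
Proof.
rewrite coroot_valuesE (bigD1 i) //= big1 ?addr0 => [|j ji].
  by rewrite diagA mxE !eqxx mulr1.
by rewrite mxE eqxx (negbTE ji) mulr0.
Qed.

Lemma bform_reflection i x : let t := coroot_values A x 0 i in
  bform S (x - t *: delta_mx 0 i) (x - t *: delta_mx 0 i) = bform S x x.
Proof.
move=> t; rewrite bformDl !bformDr !bformNl !bformNr !bformZl !bformZr.
rewrite (bformC symS x (delta_mx 0 i)) !bform_delta coroot_values_delta -/t.
ring.
Qed.

(* e is half the squared length of the root. *)
Lemma root_coroot_length b g : root_coroot A b g ->
  exists e : rat, [/\ 0 < e,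
    forall i, (b 0 i)%:~R * d 0 i = e * (g 0 i)%:~R &
    bform S (map_mx intr b) (map_mx intr b) = 2 * e].
Proof.
elim=> [i|i {}b {}g _ [e [e0 bg qb]]].
  exists (d 0 i); split=> // [j|].
    by rewrite !mxE eqxx /=; case: eqP => [->|_]; rewrite ?mul0r ?mulr0 // mulrC.
  have -> : map_mx intr (delta_mx 0 i : 'rV[int]_n) = delta_mx 0 i :> 'rV[rat]_n.
    by apply/rowP=> j; rewrite !mxE; case: (_ && _).
  by rewrite bform_delta coroot_values_delta mulrC.
have tE : ((b *m A^T) 0 i)%:~R = coroot_values A (map_mx intr b) 0 i.
  rewrite coroot_valuesE mxE rmorph_sum; apply: eq_bigr => j _.
  by rewrite !mxE rmorphM mulrC.
exists e; split=> //.
  move=> j; rewrite !mxE !eqxx /=; case: eqP => [->|_]; last first.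
    by rewrite !mulr0 !subr0 bg.
  rewrite !mulr1 !rmorphB /= mulrBl mulrBr bg; congr (_ - _).
  rewrite !rmorph_sum /= mulr_suml mulr_sumr; apply: eq_bigr => k _.
  (* The sums match term by term: symmetry of d A and the relation between b and g give b_k A_ik d_i
     = b_k d_k A_ki = e g_k A_ki. *)
  rewrite !mxE !rmorphM /= mulrA -bg -!mulrA; congr (_ * _).
  by rewrite symmetrized_entries mulrC.
have := bform_reflection i (map_mx intr b); rewrite /= -tE -qb => <-.
have -> // : map_mx intr (b - (b *m A^T) 0 i *: delta_mx 0 i)
  = map_mx intr b - ((b *m A^T) 0 i)%:~R *: delta_mx 0 i :> 'rV[rat]_n.
by rewrite map_mxB map_mxZ map_delta_mx.
Qed.

End Symmetrizable.

(** * The semidefinite form of an affine Cartan matrix *)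

(* a is the coefficient vector of delta on the simple roots. *)
Record affine_cartan l (A : 'M[int]_l.+1) (d a : 'rV[rat]_l.+1) : Prop := {
  affine_diag : forall i, A i i = 2;
  affine_offdiag : forall i j, i != j -> A i j <= 0;
  affine_sym_gt0 : forall i, 0 < d 0 i;
  affine_sym : (symmetrized d A)^T = symmetrized d A;
  affine_psd : forall x, 0 <= bform (symmetrized d A) x x;
  affine_ker : forall x, bform (symmetrized d A) x x = 0 ->
    exists t, x = t *: a;
  affine_null_gt0 : forall i, 0 < a 0 i;
  affine_null : coroot_values A a = 0;
  affine_null0 : a 0 ord0 = 1 }.

(** The affine form is the pullback of the positive definite form of [A0] along the projection [B]
    modulo delta, which sends alpha_0 to -theta. It is therefore positive semidefinite, with kernel
    spanned by delta = alpha_0 + theta. *)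
Lemma untwisted_affine_cartan l (A : 'M[int]_l.+1) :
  untwisted_affine A -> exists d a, affine_cartan A d a.
Proof.
case=> A0 [theta [thetav [[l0 diag0 off0 [d0 [d0pos symS0 pos0]] _] [rth hth] ->]]].
have [e [e0 bg qth]] := root_coroot_length diag0 d0pos symS0 rth.
set S0 := diag_mx d0 *m _ in symS0 pos0.
pose th : 'rV[rat]_l := map_mx intr theta.
have thd : th *m diag_mx d0 = e *: map_mx intr thetav.
  by apply/rowP=> j; rewrite mul_mx_diag !mxE bg.
(* The highest root dominates every simple root, so its coefficients are at least 1. *)
have th_gt0 i : 0 < th 0 i.
  have := hth _ _ (RootCorootSimple A0 i) i.
  by rewrite !mxE !eqxx /= ltr0z; apply: lt_le_trans.
(* A negative pairing would make the reflected root exceed theta in coordinate i. *)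
have Ath i : 0 <= (A0 *m theta^T) i 0.
  have := hth _ _ (RootCorootRefl i rth) i.
  suff -> : (A0 *m theta^T) i 0 = (theta *m A0^T) 0 i.
    by rewrite !mxE !eqxx /= mulr1 gerBl.
  by rewrite !mxE; apply: eq_bigr => j _; rewrite !mxE mulrC.
(* The coefficient [e], half the squared length of theta, symmetrizes the row of alpha_0; [a] is
   alpha_0 + theta. *)
pose d : 'rV[rat]_(1 + l) := row_mx e%:M d0.
pose a : 'rV[rat]_(1 + l) := row_mx 1%:M th.
pose B : 'M[rat]_(1 + l, l) := col_mx (- th) 1%:M.
rewrite {A}; set A := extended_cartan_matrix _ _ _.
have thS : th *m S0 = e *: (map_mx intr thetav *m map_mx intr A0).
  by rewrite mulmxA thd -scalemxAl.
have SE : symmetrized d A = B *m S0 *m B^T.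
  rewrite /symmetrized /A /extended_cartan_matrix /d /B.
  rewrite diag_mx_row map_block_mx mulmx_block !mul0mx !addr0 !add0r.
  rewrite mul_col_mx tr_col_mx mul_col_row !mulNmx mul1mx linearN /= trmx1.
  rewrite !mulmxN !mulmx1 opprK; congr block_mx.
  - apply/matrixP=> i j; rewrite !ord1 mul_diag_mx.
    by rewrite -[RHS]/(bform S0 th th) qth !mxE mulrC.
  - rewrite thS map_mxN map_mxM; apply/matrixP=> i j; rewrite !ord1 mul_diag_mx !mxE.
    by rewrite mulrN.
  - rewrite map_mxN map_mxM map_trmx mulmxN mulmxA -/S0.
    by [].
have BE x : x *m B = rsubmx x - lsubmx x *m th.
  by rewrite -{1}[x]hsubmxK mul_row_col mulmx1 mulmxN addrC.
have qE x : bform (symmetrized d A) x x = bform S0 (x *m B) (x *m B).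
  by rewrite /bform SE trmx_mul !mulmxA.
have pos0' x : 0 <= bform S0 x x.
  by case: (eqVneq x 0) => [->|/pos0/ltW //]; rewrite /bform !mul0mx mxE.
have d_gt0 i : 0 < d 0 i.
  rewrite -(@splitK 1 l i) /=; case: (fintype.split i) => j; rewrite ?row_mxEl ?row_mxEr //.
  by rewrite mxE ord1 eqxx.
have symS : (symmetrized d A)^T = symmetrized d A.
  by rewrite SE trmx_mul trmxK trmx_mul symS0 mulmxA.
have aB0 : a *m B = 0 by rewrite BE row_mxKl row_mxKr mul1mx subrr.
have diagA (i : 'I_(1 + l)) : A i i = 2.
  rewrite -(@splitK 1 l i) /=; case: (fintype.split i) => j.
    by rewrite block_mxEul mxE eqxx.
  by rewrite block_mxEdr diag0.
have offA (i j : 'I_(1 + l)) : i != j -> A i j <= 0.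
  have col k : A (rshift 1 k) (lshift l ord0) <= 0.
    by rewrite block_mxEdl mxE oppr_le0 Ath.
  rewrite -(@splitK 1 l i) -(@splitK 1 l j) /=.
  case: (fintype.split i) => i'; case: (fintype.split j) => j' //=.
  + by rewrite !ord1 eqxx.
  (* The sign in the first row follows from the first column by symmetry of the form. *)
  + rewrite !ord1 => _; have := symmetrized_entries symS (lshift l ord0) (rshift 1 j').
    move=> h; have : d 0 (lshift l ord0) * (A (lshift l ord0) (rshift 1 j'))%:~R <= 0.
      by rewrite h pmulr_rle0 // lerz0 col.
    by rewrite pmulr_rle0 // lerz0.
  + by rewrite !ord1 => _; apply: col.
  + move=> ij; have ij' : i' != j' by apply: contra_neq ij => ->.
    by rewrite block_mxEdr; case: (off0 _ _ ij').
have psd x : 0 <= bform (symmetrized d A) x x.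
  by rewrite qE.
have kerA x : bform (symmetrized d A) x x = 0 -> exists t, x = t *: a.
  rewrite qE => q0; exists (x 0 (lshift l ord0)).
  have /eqP : x *m B = 0.
    by apply: contra_eq q0 => /pos0 q; rewrite gt_eqF.
  rewrite BE subr_eq0 => /eqP h; rewrite -[LHS]hsubmxK h /a scale_row_mx.
  have xl : lsubmx x = (x 0 (lshift l ord0))%:M.
    by apply/matrixP=> i j; rewrite !ord1 !mxE eqxx.
  by rewrite {2}xl mul_scalar_mx xl scalemx1.
have a_gt0 (i : 'I_(1 + l)) : 0 < a 0 i.
  rewrite -(@splitK 1 l i) /=; case: (fintype.split i) => j; rewrite ?row_mxEl ?row_mxEr //.
  by rewrite mxE ord1 eqxx.
have nullA : coroot_values A a = 0.
  apply/rowP=> i; rewrite [RHS]mxE; apply/eqP.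
  rewrite -(mulrI_eq0 _ (lregP (lt0r_neq0 (d_gt0 i)))).
  by rewrite -bform_delta /bform SE -!mulmxA -trmx_mul aB0 trmx0 !mulmx0 mxE.
have a0 : a 0 (lshift l ord0) = 1.
  by rewrite row_mxEl mxE.
exists d, a; split=> //.
by rewrite -[RHS]a0; congr (a _ _); apply: val_inj.
Qed.


(** * Every real root is positive or negative *)

Lemma sum_sym_even n (M : 'I_n -> 'I_n -> int) :
  (forall i j, M i j = M j i) -> (forall i, exists k, M i i = 2 * k) ->
  exists k, \sum_i \sum_j M i j = 2 * k.
Proof.
elim: n M => [|n IH] M symM diagM; first by exists 0; rewrite big_ord0.
have [k hk] := IH (fun i j => M (lift ord0 i) (lift ord0 j))
  (fun i j => symM _ _) (fun i => diagM _).
have [k0 hk0] := diagM ord0.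
(* Row 0 and column 0 contribute equally off the diagonal, so half of the total is half the corner,
   plus one row, plus half of the remaining block. *)
exists (k0 + \sum_(i < n) M ord0 (lift ord0 i) + k).
rewrite big_ord_recl big_ord_recl hk0.
under [X in _ + X]eq_bigr => i _ do rewrite big_ord_recl symM.
by rewrite big_split /= hk; ring.
Qed.

Section AffineRoots.
Variables (l : nat) (A : 'M[int]_l.+1) (d a : 'rV[rat]_l.+1).
Hypothesis affA : affine_cartan A d a.
Local Notation S := (symmetrized d A).

Let diagA := affine_diag affA.
Let offA := affine_offdiag affA.
Let d_gt0 := affine_sym_gt0 affA.
Let symS := affine_sym affA.

(** The value is [e] times the sum of the integers g_i A_ij b_j. By the proportionality these are
    symmetric in i and j, and the diagonal ones are 2 g_i b_i, so the sum is even. *)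
Lemma bform_proportional_even (b g : 'rV[int]_l.+1) e : 0 < e ->
  (forall i, (b 0 i)%:~R * d 0 i = e * (g 0 i)%:~R) ->
  exists2 k : int, 0 <= k &
    bform S (map_mx intr b) (map_mx intr b) = 2 * e * k%:~R.
Proof.
move=> e0 bg.
have [||k hk] := @sum_sym_even l.+1 (fun i j => g 0 i * A i j * b 0 j).
- move=> i j; apply/eqP; rewrite -(eqr_int rat) -(inj_eq (mulfI (lt0r_neq0 e0))).
  rewrite !rmorphM /= !mulrA -!bg; apply/eqP.
  rewrite -[(b 0 i)%:~R * _ * _]mulrA (symmetrized_entries symS); ring.
- by move=> i; exists (g 0 i * b 0 i); rewrite diagA; ring.
have qE : bform S (map_mx intr b) (map_mx intr b) = 2 * e * k%:~R.
  transitivity (e * (2 * k)%:~R); last by rewrite rmorphM /=; ring.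
  rewrite -hk bform_sumE rmorph_sum mulr_sumr; apply: eq_bigr => i _.
  rewrite rmorph_sum mulr_sumr; apply: eq_bigr => j _.
  by rewrite symmetrizedE !mxE !rmorphM /= !mulrA bg.
exists k => //; have := affine_psd affA (map_mx intr b).
by rewrite qE pmulr_rge0 ?ler0z // mulr_gt0.
Qed.

(* The squared lengths of the positive and negative parts of a root are
   integral multiples of that of the root, and their sum is at most that of the
   root, so that one of the parts is isotropic. *)
Lemma root_coroot_sign b g : root_coroot A b g ->
  (forall i, 0 <= b 0 i) \/ (forall i, b 0 i <= 0).
Proof.
move=> /(root_coroot_length diagA d_gt0 symS)[e [e0 bg qb]].
pose pos (x : 'rV[int]_l.+1) : 'rV[int]_l.+1 := \row_i Num.max (x 0 i) 0.
(* As [e] and [d] are positive, the entries of b' and g' have the same signs, so the positive parts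
   stay proportional. *)
have pos_prop (b' g' : 'rV[int]_l.+1) :
    (forall i, (b' 0 i)%:~R * d 0 i = e * (g' 0 i)%:~R) ->
    forall i, ((pos b') 0 i)%:~R * d 0 i = e * ((pos g') 0 i)%:~R.
  move=> h i; rewrite !mxE; have hi := h i.
  have : (0 < b' 0 i) = (0 < g' 0 i).
    by rewrite -(ltr0z rat) -(pmulr_lgt0 _ (d_gt0 i)) hi pmulr_rgt0 ?ltr0z.
  by case: (ltP 0 (b' 0 i)); case: (ltP 0 (g' 0 i)) => //= _ _ _; rewrite ?mulr0 ?mul0r.
have [k k0 qp] := bform_proportional_even e0 (pos_prop _ _ bg).
have bgN i : ((- b) 0 i)%:~R * d 0 i = e * ((- g) 0 i)%:~R.
  by rewrite !mxE !rmorphN /= mulNr mulrN bg.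
have [k' k'0 qm] := bform_proportional_even e0 (pos_prop _ _ bgN).
set p := map_mx intr (pos b) in qp; set m := map_mx intr (pos (- b)) in qm.
have bE : map_mx intr b = p - m.
  apply/rowP=> i; rewrite !mxE -rmorphB; congr intr.
  by move: (b 0 i) => x; rewrite !maxEle; case: ifP; case: ifP; lia.
(* The two parts have disjoint supports, and off-diagonal entries are nonpositive. *)
have pm_le0 : bform S p m <= 0.
  rewrite bform_sumE; apply: sumr_le0 => i _; apply: sumr_le0 => j _.
  have pi : 0 <= p 0 i by rewrite !mxE ler0z le_max lexx orbT.
  have mj : 0 <= m 0 j by rewrite !mxE ler0z le_max lexx orbT.
  case: (eqVneq i j) => [<-|ij].
    suff : p 0 i = 0 \/ m 0 i = 0.
      by case=> ->; rewrite ?mul0r ?mulr0.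
    rewrite !mxE; case: (leP (b 0 i) 0) => h; [left|right].
      by [].
    by rewrite max_r // oppr_le0 ltW.
  apply: mulr_le0_ge0 => //; apply: mulr_ge0_le0 => //.
  by rewrite symmetrizedE pmulr_rle0 // lerz0 offA.
(* The squared length of b is that of p plus that of m minus 2 (p, m); compare in units of 2e. *)
have kk' : k + k' <= 1.
  have := qb; rewrite bE bformDl !bformDr !bformNl !bformNr qp qm (bformC symS m p).
  move=> qE; rewrite -(ler_int rat) -(ler_pM2l (mulr_gt0 (ltr0n _ 2) e0)) mulr1.
  by rewrite rmorphD /= mulrDr; lra.
(* An isotropic vector is a multiple of [a], whose coordinates are all positive, so an isotropic
   positive part is zero or positive everywhere. *)
have isotropic (x : 'rV[int]_l.+1) : bform S (map_mx intr (pos x)) (map_mx intr (pos x)) = 0 ->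
    (forall i, x 0 i <= 0) \/ (forall i, 0 <= x 0 i).
  move=> /(affine_ker affA)[t tE].
  have xt i : (Num.max (x 0 i) 0)%:~R = t * a 0 i.
    by have /rowP/(_ i) := tE; rewrite !mxE.
  have [t0|t0] := leP t 0; [left|right] => i; have := xt i.
    have : t * a 0 i <= 0 by rewrite pmulr_lle0 ?(affine_null_gt0 affA).
    by move=> h1 h2; move: h1; rewrite -h2 lerz0 maxEle; case: ifP; lia.
  have : 0 < t * a 0 i by rewrite pmulr_lgt0 ?(affine_null_gt0 affA).
  by move=> h1 h2; move: h1; rewrite -h2 ltr0z maxEle; case: ifP; lia.
have [k00|k'00] : k = 0 \/ k' = 0 by lia.
  by move: qp; rewrite k00 mulr0 => /isotropic []; [right|left].
move: qm; rewrite k'00 mulr0 => /isotropic [] h; [left|right] => i; have := h i;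
  by rewrite mxE ?oppr_le0 ?oppr_ge0.
Qed.

(** The reflection alters only coordinate k and makes the root nonpositive, so all other coordinates
    of b vanish. Comparing lengths then shows that the multiple of alpha_k is 1. *)
Lemma root_coroot_flip b g k : root_coroot A b g -> (forall i, 0 <= b 0 i) ->
  ~ (forall i, 0 <= (b - (b *m A^T) 0 k *: delta_mx 0 k) 0 i) ->
  b = delta_mx 0 k /\ g = delta_mx 0 k.
Proof.
move=> rb b_ge0 nb'.
have [//|b'_le0] := root_coroot_sign (RootCorootRefl k rb).
have [e [e0 bg qb]] := root_coroot_length diagA d_gt0 symS rb.
have b0 i : i != k -> b 0 i = 0.
  move=> ik; have := b'_le0 i; rewrite !mxE (negbTE ik) andbF mulr0 subr0.
  by move=> h; apply/le_anti; rewrite h b_ge0.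
have g0 i : i != k -> g 0 i = 0.
  move=> ik; have := bg i; rewrite b0 // mul0r => /esym/eqP.
  by rewrite mulf_eq0 gt_eqF //= intr_eq0 => /eqP.
have bE : b = b 0 k *: delta_mx 0 k.
  apply/rowP=> i; rewrite !mxE eqxx; case: eqP => [->|/eqP ik]; rewrite ?mulr1 ?mulr0 //.
  exact: b0.
(* The form on b equals 2e, and also 2e b_k g_k. *)
have : (b 0 k) * (g 0 k) = 1.
  have : bform S (map_mx intr b) (map_mx intr b) = 2 * e * (b 0 k * g 0 k)%:~R.
    rewrite [in LHS]bE map_mxZ map_delta_mx bformZl bformZr bform_delta.
    rewrite (coroot_values_delta diagA) rmorphM /=.
    transitivity (2 * (b 0 k)%:~R * ((b 0 k)%:~R * d 0 k)); first by ring.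
    by rewrite bg; ring.
  rewrite qb => h; apply/eqP; rewrite -(eqr_int rat).
  by rewrite -(inj_eq (mulfI (lt0r_neq0 (mulr_gt0 (ltr0n _ 2) e0)))) -h mulr1.
move=> bg1; have bk1 : b 0 k = 1.
  move: (b_ge0 k) bg1; rewrite mulrC => + /intUnitRing.unitzPl.
  by move: (b 0 k) => x x0 /orP[] /eqP // xE; rewrite xE in x0.
have gk1 : g 0 k = 1 by move: bg1; rewrite bk1 mul1r.
split; first by rewrite bE bk1 scale1r.
apply/rowP=> i; rewrite !mxE eqxx; case: eqP => [->|/eqP ik] //.
exact: g0.
Qed.

End AffineRoots.


(** * Simple reflections acting on weights, roots and coroots *)

Section WeylGroup.
Variables (K : numFieldType) (l : nat) (A : 'M[int]_l.+1).
Implicit Types (mu : weight K l) (x y : 'rV[rat]_l.+1) (J : {set 'I_l.+1}).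

Definition root_comb x : weight K l :=
  map_mx ratr x *m \matrix_j simple_root K A j.

Definition supported J x := forall i, i \notin J -> x 0 i = 0.

(** Only the values on the simple coroots are prescribed; the coordinate along delta stays free. *)
Definition has_values mu (m : 'rV[rat]_l.+1) :=
  forall i, pairing mu (coroot i) = ratr (m 0 i).

Lemma pairingE mu i : pairing mu (coroot i) = mu 0 (lift ord_max i).
Proof.
rewrite /pairing mxE (bigD1 (lift ord_max i)) //= mxE !eqxx mulr1 big1 ?addr0 //.
by move=> j ji; rewrite mxE (negbTE ji) mulr0.
Qed.

Lemma pairingD mu nu h : pairing (mu + nu) h = pairing mu h + pairing nu h.
Proof. by rewrite /pairing mulmxDl mxE. Qed.

Lemma pairingB mu nu h : pairing (mu - nu) h = pairing mu h - pairing nu h.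
Proof. by rewrite /pairing mulmxBl !mxE. Qed.

Lemma pairingZ t mu h : pairing (t *: mu) h = t * pairing mu h.
Proof. by rewrite /pairing -scalemxAl mxE. Qed.

Lemma pairing_simple_root i j :
  pairing (simple_root K A j) (coroot i) = (A i j)%:~R.
Proof.
rewrite pairingE mxE summxE (bigD1 i) //= big1 => [|k ki].
  by rewrite !mxE !eqxx /= mulr1 addr0 lift_eqF mulr0 addr0.
by rewrite !mxE eqxx (inj_eq lift_inj) eq_sym (negbTE ki) mulr0.
Qed.

Lemma root_combD x y : root_comb (x + y) = root_comb x + root_comb y.
Proof. by rewrite /root_comb map_mxD mulmxDl. Qed.

Lemma root_combB x y : root_comb (x - y) = root_comb x - root_comb y.
Proof. by rewrite /root_comb map_mxB mulmxBl. Qed.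

Lemma root_combZ t x : root_comb (t *: x) = ratr t *: root_comb x.
Proof. by rewrite /root_comb map_mxZ scalemxAl. Qed.

Lemma root_comb0 : root_comb 0 = 0.
Proof. by rewrite /root_comb map_mx0 mul0mx. Qed.

Lemma root_comb_sum (I : Type) (r : seq I) (F : I -> 'rV[rat]_l.+1) :
  root_comb (\sum_(i <- r) F i) = \sum_(i <- r) root_comb (F i).
Proof. exact: (big_morph _ root_combD root_comb0). Qed.

Lemma root_comb_delta j : root_comb (delta_mx 0 j) = simple_root K A j.
Proof. by rewrite /root_comb map_delta_mx -rowE rowK. Qed.

Lemma root_combE x p :
  root_comb x 0 p = \sum_j ratr (x 0 j) * simple_root K A j 0 p.
Proof.
by rewrite mxE; apply: eq_bigr => j _; rewrite mxE [X in _ * X]mxE.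
Qed.

Lemma root_comb_values x : has_values (root_comb x) (coroot_values A x).
Proof.
move=> i; rewrite coroot_valuesE rmorph_sum pairingE root_combE.
apply: eq_bigr => j _; rewrite rmorphM /= ratr_int -pairing_simple_root.
by rewrite pairingE mulrC.
Qed.

Lemma root_comb_ord_max x : root_comb x 0 ord_max = ratr (x 0 ord0).
Proof.
have rootE j : simple_root K A j 0 ord_max = (j == ord0)%:R.
  rewrite mxE summxE big1 ?add0r => [|i _]; first by rewrite !mxE !eqxx mulr1.
  by rewrite !mxE eqxx eq_liftF mulr0.
rewrite root_combE (bigD1 ord0) //= big1 => [|j j0]; rewrite rootE.
  by rewrite eqxx mulr1 addr0.
by rewrite (negbTE j0) mulr0.
Qed.

Lemma has_valuesB mu m x : has_values mu m ->
  has_values (mu - root_comb x) (m - coroot_values A x).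
Proof.
by move=> mum i; rewrite pairingB mum root_comb_values !mxE rmorphB.
Qed.

Lemma mul_reflection mu i : mu *m simple_reflection K A i =
  mu - pairing mu (coroot i) *: simple_root K A i.
Proof.
rewrite /simple_reflection mulmxBr mulmx1 mulmxA.
by rewrite [mu *m coroot i]mx11_scalar mul_scalar_mx.
Qed.

Hypothesis diagA : forall i, A i i = 2.

Lemma reflection_invol i :
  simple_reflection K A i *m simple_reflection K A i = 1%:M.
Proof.
apply/row_matrixP=> p; rewrite !rowE mulmxA !mul_reflection pairingB pairingZ.
rewrite pairing_simple_root diagA mulmx1.
set t := pairing _ _; set r := simple_root _ _ _.
have -> : t - t * 2%:~R = - t by rewrite -[2%:~R]/(2 : K); ring.
by rewrite scaleNr opprK subrK.
Qed.

(** Weights are row vectors, so the head of the word acts on them first. *)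
Fixpoint wordmx (u : seq 'I_l.+1) : 'M[K]_l.+2 :=
  if u is j :: u' then simple_reflection K A j *m wordmx u' else 1%:M.

Lemma wordmx_rcons u k : wordmx (rcons u k) = wordmx u *m simple_reflection K A k.
Proof.
by elim: u => [|j u IH] /=; rewrite ?mulmx1 ?mul1mx // IH mulmxA.
Qed.

Lemma weyl_word J (w : 'M[K]_l.+2) : weyl A J w -> exists2 u, {subset u <= J} & w = wordmx u.
Proof.
elim=> [|j {}w jJ _ [u uJ ->]]; first by exists [::].
by exists (j :: u) => // k; rewrite inE => /orP[/eqP->|/uJ].
Qed.

Lemma word_weyl J u : {subset u <= J} -> weyl A J (wordmx u).
Proof.
elim: u => [|j u IH] uJ; first exact: Weyl1.
apply: WeylM; first by rewrite uJ ?mem_head.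
by apply: IH => k ku; rewrite uJ // inE ku orbT.
Qed.

Lemma weyl_rcons J (w : 'M[K]_l.+2) j : j \in J -> weyl A J w ->
  weyl A J (w *m simple_reflection K A j).
Proof.
move=> jJ /weyl_word[u uJ ->]; rewrite -wordmx_rcons; apply: word_weyl => k.
by rewrite mem_rcons inE => /orP[/eqP->|/uJ].
Qed.

Lemma weyl_mul J (w w' : 'M[K]_l.+2) : weyl A J w -> weyl A J w' -> weyl A J (w *m w').
Proof.
by elim=> [|j {}w jJ _ IH] w'J; rewrite ?mul1mx // -mulmxA; apply: WeylM (IH w'J).
Qed.

Lemma weyl_sub J J' (w : 'M[K]_l.+2) : J \subset J' -> weyl A J w -> weyl A J' w.
Proof.
move=> /fintype.subsetP JJ' /weyl_word[u uJ ->].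
by apply: word_weyl => k /uJ/JJ'.
Qed.

Definition coroot_comb (g : 'rV[int]_l.+1) : cartan K l :=
  \sum_i (g 0 i)%:~R *: coroot i.

Lemma coroot_comb_delta i : coroot_comb (delta_mx 0 i) = coroot i.
Proof.
rewrite /coroot_comb (bigD1 i) //= mxE !eqxx scale1r big1 ?addr0 // => j ji.
by rewrite mxE (negbTE ji) andbF scale0r.
Qed.

(** With [root_comb_reflection], this identifies the recursion in [root_coroot] with the action of
    reflections on coroots from the left and on roots from the right. *)
Lemma mul_reflection_coroot_comb g k :
  simple_reflection K A k *m coroot_comb g =
  coroot_comb (g - (g *m A) 0 k *: delta_mx 0 k).
Proof.
rewrite /simple_reflection mulmxBl mul1mx -mulmxA.
have -> : simple_root K A k *m coroot_comb g = ((g *m A) 0 k)%:~R%:M.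
  rewrite [LHS]mx11_scalar; congr _%:M.
  rewrite /coroot_comb mulmx_sumr summxE mxE rmorph_sum; apply: eq_bigr => i _.
  by rewrite -scalemxAr mxE rmorphM /= -[X in _ * X]/(pairing _ _) pairing_simple_root.
rewrite mul_mx_scalar -coroot_comb_delta /coroot_comb scaler_sumr -sumrB.
by apply: eq_bigr => i _; rewrite scalerA -scalerBl !mxE rmorphB rmorphM.
Qed.

Lemma root_comb_reflection (b : 'rV[int]_l.+1) k :
  root_comb (map_mx intr b) *m simple_reflection K A k =
  root_comb (map_mx intr (b - (b *m A^T) 0 k *: delta_mx 0 k)).
Proof.
rewrite mul_reflection root_comb_values map_mxB map_mxZ map_delta_mx.
rewrite root_combB root_combZ root_comb_delta; congr (_ - ratr _ *: _).
rewrite coroot_valuesE mxE rmorph_sum; apply: eq_bigr => j _.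
by rewrite !mxE rmorphM mulrC.
Qed.

End WeylGroup.


(** * Bounds from positive definite forms *)

Section PositiveDefinite.
Variables (n : nat) (S : 'M[rat]_n).
Hypothesis symS : S^T = S.
Hypothesis posS : forall x, x != 0 -> 0 < bform S x x.

(** On (x, x) y - (x, y) x the form is nonnegative and equals (x, x) times the difference of the two
    sides. *)
Lemma posdef_cauchy_schwarz x y :
  bform S x y ^+ 2 <= bform S x x * bform S y y.
Proof.
have [->|/posS x0] := eqVneq x 0; first by rewrite /bform !mul0mx mxE expr0n mul0r.
have psd z : 0 <= bform S z z.
  by have [->|/posS/ltW //] := eqVneq z 0; rewrite /bform !mul0mx mxE.
have := psd (bform S x x *: y - bform S x y *: x).
rewrite bformDl !bformDr !bformNl !bformNr !bformZl !bformZr (bformC symS y x).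
move=> h; rewrite -subr_ge0 -(pmulr_rge0 _ x0); apply: le_trans h _.
by rewrite le_eqVlt; apply/orP; left; apply/eqP; ring.
Qed.

Lemma posdef_unit : S \in unitmx.
Proof.
rewrite -row_free_unit; apply: inj_row_free => x xS.
by apply/eqP/negPn/negP => /posS; rewrite /bform xS mul0mx mxE ltxx.
Qed.

(** With [v] dual to r, the equation says (x - v, x - v) = (v, v). Coordinates are pairings with the
    dual vectors [u i], so Cauchy-Schwarz bounds them on this sphere. *)
Lemma posdef_sphere_bounded (r : 'rV[rat]_n) : exists N : nat, forall x,
  bform S x x = 2 * \sum_i x 0 i * r 0 i -> forall i, `|x 0 i| <= N%:R.
Proof.
pose v := r *m invmx S.
have vE x : bform S v x = \sum_i x 0 i * r 0 i.
  rewrite /bform /v mulmxKV ?posdef_unit // mxE; apply: eq_bigr => i _.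
  by rewrite mxE mulrC.
pose u i : 'rV[rat]_n := delta_mx 0 i *m invmx S.
have uE i x : bform S (u i) x = x 0 i.
  by rewrite /bform /u mulmxKV ?posdef_unit // -rowE !mxE.
pose C i := bform S (u i) (u i) * bform S v v + 1 + `|v 0 i|.
have C_ge0 i : 0 <= C i.
  rewrite addr_ge0 // addr_ge0 //; apply: le_trans (posdef_cauchy_schwarz _ _).
  exact: sqr_ge0.
exists (Num.bound (\sum_i C i)) => x xE i.
have Nle : C i <= (Num.bound (\sum_i C i))%:R.
  apply: ltW; apply: le_lt_trans (archi_boundP _); last exact: sumr_ge0.
  by rewrite (bigD1 i) //= lerDl sumr_ge0.
apply: le_trans Nle.
have := posdef_cauchy_schwarz (u i) (x - v).
have -> : bform S (x - v) (x - v) = bform S v v.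
  rewrite bformDl !bformDr !bformNl !bformNr (bformC symS x v) xE vE; ring.
rewrite uE mxE [(- v) 0 i]mxE => h.
(* From y^2 <= z follows y <= z + 1, which avoids square roots. *)
have h1 : `|x 0 i - v 0 i| <= bform S (u i) (u i) * bform S v v + 1.
  move: h; rewrite -real_normK ?num_real //.
  set y : rat := `|_|; set z : rat := _ * _ => yz.
  by have := sqr_ge0 (y - 1); have := sqr_ge0 y; lra.
rewrite -[x 0 i](subrK (v 0 i)); apply: le_trans (ler_normD _ _) _.
by rewrite lerD2r.
Qed.

End PositiveDefinite.

(** * Deletion in words, dominance order, finiteness of W_J *)

Section AffineWeyl.
Variables (K : numFieldType) (l : nat) (A : 'M[int]_l.+1).
Variables (d a : 'rV[rat]_l.+1).
Hypothesis affA : affine_cartan A d a.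
Local Notation S := (symmetrized d A).
Local Notation root_comb := (@root_comb K l A).
Local Notation wordmx := (@wordmx K l A).
Implicit Types (mu : weight K l) (J : {set 'I_l.+1}).

Let diagA := affine_diag affA.
Let symS := affine_sym affA.

(** Follow alpha_j through the word, one letter at a time. The first letter that turns the root
    negative meets it as a simple root, and that letter cancels against j. The coroot is carried
    along because commuting the reflection past the word needs both. *)
Lemma word_deletion J j u : j \in J -> {subset u <= J} ->
  exists b g, [/\ root_coroot A b g,
    simple_root K A j *m wordmx u = root_comb (map_mx intr b),
    wordmx u *m coroot_comb K g = coroot j,
    (forall i, i \notin J -> b 0 i = 0) &
    (forall i, 0 <= b 0 i) \/
    exists v, [/\ (size v < size u)%N, {subset v <= J} &
      wordmx (j :: u) = wordmx v]].
Proof.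
move=> jJ; elim/last_ind: u => [|u k IH] uJ.
  exists (delta_mx 0 j), (delta_mx 0 j); split.
  - exact: RootCorootSimple.
  - by rewrite /= mulmx1 map_delta_mx root_comb_delta.
  - by rewrite /= mul1mx coroot_comb_delta.
  - by move=> i iJ; rewrite mxE [i == j](contraNF _ iJ) ?andbF // => /eqP->.
  - by left=> i; rewrite mxE; case: (_ && _).
have kJ : k \in J by rewrite uJ // mem_rcons mem_head.
have {}uJ : {subset u <= J} by move=> i iu; rewrite uJ // mem_rcons inE iu orbT.
have [b [g [rb bE gE bJ sgn]]] := IH uJ.
exists (b - (b *m A^T) 0 k *: delta_mx 0 k), (g - (g *m A) 0 k *: delta_mx 0 k).
split.
- exact: RootCorootRefl.
- by rewrite wordmx_rcons mulmxA bE root_comb_reflection.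
- rewrite wordmx_rcons -mulmxA -mul_reflection_coroot_comb.
  by rewrite [simple_reflection _ _ _ *m (_ *m _)]mulmxA reflection_invol // mul1mx.
- move=> i iJ; rewrite !mxE bJ // [i == k](contraNF _ iJ) ?andbF ?mulr0 ?subr0 //.
  by move=> /eqP->.
have [b'_ge0|nb'] := pselect (forall i, 0 <= (b - (b *m A^T) 0 k *: delta_mx 0 k) 0 i).
  by left.
(* A shortening found earlier survives appending k. *)
right; case: sgn => [b_ge0|[v [vu vJ vE]]]; last first.
  exists (rcons v k); split; first by rewrite !size_rcons.
    by move=> i; rewrite mem_rcons inE => /orP[/eqP->|/vJ].
  by rewrite -rcons_cons !wordmx_rcons vE.
have [bk gk] := root_coroot_flip affA rb b_ge0 nb'.
exists u; split=> //; first by rewrite size_rcons.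
rewrite /= wordmx_rcons mulmxA.
(* With w the word [u], alpha_j w = alpha_k and w alpha_k^vee = alpha_j^vee give s_j w = w s_k, and
   the two letters k cancel. *)
have -> : simple_reflection K A j *m wordmx u = wordmx u *m simple_reflection K A k.
  rewrite /simple_reflection mulmxBl mul1mx mulmxBr mulmx1; congr (_ - _).
  rewrite -mulmxA bE bk map_delta_mx root_comb_delta -gE gk coroot_comb_delta.
  by rewrite mulmxA.
by rewrite -mulmxA reflection_invol // mulmx1.
Qed.

(** Induction on the length of a word. If alpha_j w is a nonnegative combination of simple roots,
    the first letter j adds m_j times it to the displacement; otherwise the word can be
    shortened. *)
Lemma weyl_dominant_le J mu m (w : 'M[K]_l.+2) :
  has_values mu m -> (forall i, 0 <= m 0 i) -> weyl A J w ->
  exists n : 'rV[rat]_l.+1, [/\ forall i, 0 <= n 0 i, supported J n &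
    mu *m w = mu - root_comb n].
Proof.
move=> mum m_ge0 /weyl_word[u uJ ->].
have [s] := ubnP (size u); elim: s u uJ => // s IH [|j u] uJ /= us.
  exists 0; split=> [i|i _|]; rewrite ?mxE //.
  by rewrite mulmx1 root_comb0 subr0.
have jJ : j \in J by rewrite uJ // mem_head.
have {}uJ : {subset u <= J} by move=> i iu; rewrite uJ // inE iu orbT.
have [b [g [_ bE _ bJ [b_ge0|[v [vu vJ]]]]]] := word_deletion jJ uJ; last first.
  by move=> /= ->; apply: IH => //; apply: leq_trans vu _; rewrite ltnW.
have [n [n_ge0 nJ nE]] := IH u uJ us.
exists (n + m 0 j *: map_mx intr b); split.
- by move=> i; rewrite !mxE addr_ge0 // mulr_ge0 // ler0z.
- by move=> i iJ; rewrite !mxE nJ // bJ // mulr0 addr0.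
rewrite mulmxA mul_reflection mulmxBl nE -scalemxAl bE mum.
by rewrite root_combD root_combZ opprD addrA.
Qed.

(* The equation says that mu and its image under w have the same length. *)
Lemma weyl_integral J mu (z : 'rV[int]_l.+1) (w : 'M[K]_l.+2) :
  has_values mu (map_mx intr z) -> weyl A J w ->
  exists n : 'rV[int]_l.+1, let x := map_mx intr n in
    [/\ supported J x, mu *m w = mu - root_comb x &
      bform S x x = 2 * \sum_i x 0 i * (d 0 i * (z 0 i)%:~R)].
Proof.
move=> muz wJ; elim: wJ mu z muz => [|j {}w jJ _ IH] mu z muz.
  exists 0; split; first by move=> i _; rewrite !mxE.
    by rewrite mulmx1 map_mx0 root_comb0 subr0.
  rewrite map_mx0 /bform !mul0mx mxE big1 ?mulr0 // => i _.
  by rewrite mxE mul0r.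
(* The coroot values of the reflected weight. *)
pose z' := z - z 0 j *: (\row_i A i j).
have mu'z' : has_values (mu *m simple_reflection K A j) (map_mx intr z').
  move=> i; rewrite mul_reflection pairingB pairingZ !muz pairing_simple_root.
  by rewrite !mxE !ratr_int rmorphB rmorphM.
have [n [nJ nE qn]] := IH _ _ mu'z'.
exists (n + z 0 j *: delta_mx 0 j); rewrite map_mxD map_mxZ map_delta_mx.
set x := map_mx intr n in nJ nE qn *; set t : rat := (z 0 j)%:~R.
have Sj : forall i, d 0 i * (z' 0 i)%:~R = d 0 i * (z 0 i)%:~R - t * (d 0 j * (A j i)%:~R).
  move=> i; rewrite -(symmetrized_entries symS i j) !mxE rmorphB rmorphM /=.
  by rewrite -/t; ring.
split.
- move=> i iJ; rewrite mxE nJ // !mxE [i == j](contraNF _ iJ) ?andbF ?mulr0 ?addr0 //.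
  by move=> /eqP->.
- rewrite mulmxA nE mul_reflection muz root_combD root_combZ root_comb_delta.
  by rewrite opprD addrAC -addrA mxE.
rewrite bformDl !bformDr !bformZl !bformZr (bformC symS x) !bform_delta.
rewrite coroot_values_delta // qn.
under eq_bigr => i _ do rewrite Sj mulrBr.
rewrite sumrB.
have -> : \sum_i x 0 i * (t * (d 0 j * (A j i)%:~R)) = t * (d 0 j * coroot_values A x 0 j).
  rewrite coroot_valuesE !mulr_sumr; apply: eq_bigr => i _; ring.
under [in RHS]eq_bigr => i _ do rewrite mxE mulrDl.
have jE : \sum_i (t *: delta_mx 0 j : 'rV_l.+1) 0 i * (d 0 i * (z 0 i)%:~R)
    = t * (d 0 j * t).
  rewrite (bigD1 j) //= big1 ?addr0 => [|i ij]; rewrite !mxE eqxx ?eqxx ?mulr1 //.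
  by rewrite (negbTE ij) mulr0 mul0r.
by rewrite big_split /= jE; ring.
Qed.

(** Isotropic vectors are multiples of [a], which has full support, so one that misses a coordinate
    is zero. *)
Lemma bform_supported_gt0 J x : J \proper 'I_l.+1 -> supported J x -> x != 0 ->
  0 < bform S x x.
Proof.
move=> /properP[_ [k _ kJ]] xJ; rewrite lt0r (affine_psd affA) andbT.
apply: contra_neq => /(affine_ker affA)[t xE]; have := xJ k kJ.
rewrite {1}xE mxE => /eqP; rewrite mulf_eq0 orbC gt_eqF ?(affine_null_gt0 affA) //=.
by move=> /eqP t0; rewrite xE t0 scale0r.
Qed.

(** The displacements lie on the sphere given by [weyl_integral], in the space of vectors supported
    in J, where the form is definite. *)
Lemma weyl_bounded J mu (z : 'rV[int]_l.+1) : J \proper 'I_l.+1 ->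
  has_values mu (map_mx intr z) ->
  exists N : nat, forall w : 'M[K]_l.+2, weyl A J w ->
    exists n : 'rV[int]_l.+1, mu *m w = mu - root_comb (map_mx intr n) /\
      forall i, `|n 0 i| <= N%:Z.
Proof.
move=> Jproper muz.
pose chi : 'rV[rat]_l.+1 := \row_i (i \notin J)%:R.
(* S' coincides with S on vectors supported in J and is positive definite. *)
pose S' := S + diag_mx chi.
have S'E x y : bform S' x y = bform S x y + \sum_i (i \notin J)%:R * x 0 i * y 0 i.
  rewrite /bform mulmxDr mulmxDl mxE mul_mx_diag; congr (_ + _).
  by rewrite mxE; apply: eq_bigr => i _; rewrite !mxE; ring.
have symS' : S'^T = S' by rewrite linearD /= tr_diag_mx symS.
have posS' x : x != 0 -> 0 < bform S' x x.
  move=> x0; have sum_ge0 i : true -> 0 <= (i \notin J)%:R * x 0 i * x 0 i.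
    by move=> _; rewrite -mulrA -expr2 mulr_ge0 ?sqr_ge0 ?ler0n.
  have [xJ|nxJ] := pselect (supported J x).
    rewrite S'E ltr_pwDl ?sumr_ge0 //; exact: bform_supported_gt0 xJ x0.
  move: nxJ => /existsNP[i /not_implyP[iJ /eqP xi0]].
  rewrite S'E ltr_wpDl ?(affine_psd affA) // (bigD1 i) //= iJ mul1r.
  rewrite ltr_pwDl ?sumr_ge0 //; first by rewrite -expr2 exprn_even_gt0.
  by move=> j _; apply: sum_ge0.
have [N hN] := posdef_sphere_bounded symS' posS' (\row_i (d 0 i * (z 0 i)%:~R)).
exists N => w wJ; have [n [nJ nE qn]] := weyl_integral muz wJ.
exists n; split=> // i; rewrite -(ler_int rat) intr_norm.
have := hN (map_mx intr n) _ i; rewrite mxE; apply.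
rewrite S'E qn [X in _ + X]big1 ?addr0 => [|j _].
  by congr (_ * _); apply: eq_bigr => j _; rewrite [in RHS]mxE [in RHS]mxE mxE.
by have [jJ|jJ] := boolP (j \in J); rewrite ?mul0r // mul1r nJ // mul0r.
Qed.

(** Each row of w is the image of a basis weight, hence has an integral displacement bounded
    independently of w; only finitely many matrices remain. *)
Lemma finite_weyl J : J \proper 'I_l.+1 -> finite_set (weyl (K := K) A J).
Proof.
move=> Jproper.
have bounded p : exists N : nat, forall w : 'M[K]_l.+2, weyl A J w ->
    exists n : 'rV[int]_l.+1,
      row p w = delta_mx 0 p - root_comb (map_mx intr n) /\
      forall i, `|n 0 i| <= N%:Z.
  have pz : has_values (delta_mx 0 p : weight K l)
      (map_mx intr (\row_i (lift ord_max i == p)%:R : 'rV[int]_l.+1)).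
    by move=> i; rewrite pairingE !mxE eqxx; case: eqP; rewrite ?rmorph1 ?rmorph0.
  have [N hN] := weyl_bounded Jproper pz.
  by exists N => w /hN; rewrite rowE.
have [N hN] := choice bounded.
pose M := \max_p N p.
(* Integers between -M and M are stored as ordinals shifted by M. *)
pose f (D : 'M['I_(M + M).+1]_(l.+2, l.+1)) : 'M[K]_l.+2 :=
  \matrix_p (delta_mx 0 p -
    root_comb (map_mx intr (\row_i ((D p i)%:Z - M%:Z)))).
apply: (@sub_finite_set _ _ (range f)); last exact/finite_image/finite_finset.
move=> w wJ; have [n nE] := choice (fun p => hN p w wJ).
exists (\matrix_(p, i) inord (absz (n p 0 i + M%:Z)%R)) => //.
apply/row_matrixP=> p; rewrite rowK; have [-> n_le] := nE p.
congr (_ - root_comb (map_mx _ _)); apply/rowP=> i; rewrite !mxE.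
have NM : (N p <= M)%N by apply: leq_bigmax.
have := n_le i; move: (n p 0 i) => t tN.
by rewrite inordK; lia.
Qed.

End AffineWeyl.


(** * Rational convex combinations *)

Section RationalCones.
Variables (K : numFieldType) (l : nat).
Implicit Types (T : set (weight K l)) (mu nu : weight K l).

(* Nonnegative rational combinations of total weight t, so that coneQ T 1 is
   convQ T. *)
Definition coneQ T (t : rat) : set (weight K l) :=
  [set mu | exists (n : nat) (q : 'I_n -> rat) (v : 'I_n -> weight K l),
     [/\ forall k, 0 <= q k, \sum_k q k = t, forall k, T (v k) &
         mu = \sum_k ratr (q k) *: v k]].

Lemma coneQ0 T : coneQ T 0 0.
Proof.
exists 0%N, (fun=> 0), (fun=> 0); split=> //; last by rewrite big_ord0.
- by rewrite big_ord0.
- by case.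
Qed.

Lemma coneQD T s t mu nu : coneQ T s mu -> coneQ T t nu -> coneQ T (s + t) (mu + nu).
Proof.
move=> [n [q [v [q0 <- vT ->]]]] [n' [q' [v' [q'0 <- v'T ->]]]].
pose glue (X : Type) (f : 'I_n -> X) (g : 'I_n' -> X) (k : 'I_(n + n')) :=
  match fintype.split k with inl i => f i | inr j => g j end.
have glueP X (f : 'I_n -> X) g (P : X -> Prop) :
    (forall i, P (f i)) -> (forall j, P (g j)) -> forall k, P (glue X f g k).
  by move=> Pf Pg k; rewrite /glue; case: fintype.split.
have glueL X (f : 'I_n -> X) g i : glue X f g (lshift n' i) = f i.
  by rewrite /glue (unsplitK (inl i)).
have glueR X (f : 'I_n -> X) g j : glue X f g (rshift n j) = g j.
  by rewrite /glue (unsplitK (inr j)).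
exists (n + n')%N, (glue _ q q'), (glue _ v v'); split.
- exact: (glueP _ _ _ (fun x => is_true (0 <= x))).
- by rewrite big_split_ord; congr (_ + _); apply: eq_bigr => i _; rewrite ?glueL ?glueR.
- exact: glueP.
- by rewrite big_split_ord; congr (_ + _); apply: eq_bigr => i _; rewrite ?glueL ?glueR.
Qed.

Lemma coneQZ T r t mu : 0 <= r -> coneQ T t mu -> coneQ T (r * t) (ratr r *: mu).
Proof.
move=> r0 [n [q [v [q0 <- vT ->]]]]; exists n, (fun k => r * q k), v; split=> //.
- by move=> k; rewrite mulr_ge0.
- by rewrite mulr_sumr.
- by rewrite scaler_sumr; apply: eq_bigr => k _; rewrite rmorphM scalerA.
Qed.

Lemma coneQ_sum T (X : eqType) (r : seq X) (F : X -> weight K l) :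
  (forall x, x \in r -> convQ T (F x)) ->
  coneQ T (size r)%:R (\sum_(x <- r) F x).
Proof.
elim: r => [|x r IH] FT; first by rewrite big_nil; apply: coneQ0.
rewrite big_cons /= -natr1 addrC; apply: coneQD; first by apply: FT; apply: mem_head.
by apply: IH => y yr; apply: FT; rewrite inE yr orbT.
Qed.

Lemma sub_convQ T : T `<=` convQ T.
Proof.
move=> v Tv; exists 1%N, (fun=> 1), (fun=> v); split=> //.
- by rewrite big_ord1.
- by rewrite big_ord1 rmorph1 scale1r.
Qed.

Lemma convQ_segment T s t mu nu : 0 <= s -> 0 <= t -> s + t = 1 ->
  convQ T mu -> convQ T nu -> convQ T (ratr s *: mu + ratr t *: nu).
Proof.
move=> s0 t0 st1 muT nuT; have := coneQD (coneQZ s0 muT) (coneQZ t0 nuT).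
by rewrite !mulr1 st1.
Qed.

Lemma convQ_mulmx T (w : 'M[K]_l.+2) mu :
  (forall v, T v -> T (v *m w)) -> convQ T mu -> convQ T (mu *m w).
Proof.
move=> Tw [n [q [v [q0 q1 vT ->]]]]; exists n, q, (fun k => v k *m w); split=> //.
  by move=> k; apply: Tw.
by rewrite mulmx_suml; apply: eq_bigr => k _; rewrite scalemxAl.
Qed.

End RationalCones.

(** * Averages over W_J *)

Section Average.
Variables (K : numFieldType) (l : nat) (A : 'M[int]_l.+1).
Variables (d a : 'rV[rat]_l.+1).
Hypothesis affA : affine_cartan A d a.
Local Notation S := (symmetrized d A).
Local Notation root_comb := (@root_comb K l A).
Variable J : {set 'I_l.+1}.
Hypothesis Jproper : J \proper 'I_l.+1.
Local Notation F := (fset_set (weyl (K := K) A J)).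
Implicit Types (mu nu : weight K l).

Lemma mem_weyl_fset (w : 'M[K]_l.+2) : (w \in F) <-> weyl A J w.
Proof.
by rewrite in_fset_set; [rewrite inE | exact: (finite_weyl K affA Jproper)].
Qed.

Lemma card_weyl_gt0 : (0 < #|` F|)%N.
Proof. by rewrite cardfs_gt0; apply/fset0Pn; exists 1%:M; apply/mem_weyl_fset/Weyl1. Qed.

Let cardK : (#|` F|)%:R != 0 :> K.
Proof. by rewrite pnatr_eq0 -lt0n card_weyl_gt0. Qed.

Lemma bhatB mu nu : bhat A J (mu - nu) = bhat A J mu - bhat A J nu.
Proof.
rewrite /bhat -scalerBr -sumrB; congr (_ *: _).
by apply: eq_bigr => w _; rewrite mulmxBl.
Qed.

Lemma bhatZ t mu : bhat A J (t *: mu) = t *: bhat A J mu.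
Proof.
rewrite /bhat !scalerA [t * _]mulrC -scalerA; congr (_ *: _).
by rewrite scaler_sumr; apply: eq_bigr => w _; rewrite scalemxAl.
Qed.

(** Right multiplication by s_j permutes W_J. *)
Lemma bhat_reflection mu j : j \in J ->
  bhat A J mu *m simple_reflection K A j = bhat A J mu.
Proof.
move=> jJ; rewrite /bhat -scalemxAl mulmx_suml; congr (_ *: _).
have invol := reflection_invol K (affine_diag affA) j.
have permF : perm_eq [seq w *m simple_reflection K A j | w <- F] F.
  apply: uniq_perm; [|exact: fset_uniq|].
    rewrite map_inj_uniq; first exact: fset_uniq.
    move=> w w'.
    move=> /(congr1 (mulmx^~ (simple_reflection K A j))).
    by rewrite -!mulmxA invol !mulmx1.
  move=> w; apply/mapP/idP => [[w' /mem_weyl_fset w'J ->]|/mem_weyl_fset wJ].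
    exact/mem_weyl_fset/weyl_rcons.
  exists (w *m simple_reflection K A j); first exact/mem_weyl_fset/weyl_rcons.
  by rewrite -mulmxA invol mulmx1.
rewrite -[RHS](perm_big _ permF) /= big_map.
by apply: eq_bigr => w _; rewrite mulmxA.
Qed.

Lemma bhat_pairing mu j : j \in J -> pairing (bhat A J mu) (coroot j) = 0.
Proof.
move=> /(bhat_reflection mu)/eqP; rewrite mul_reflection -subr_eq0 addrAC subrr add0r.
rewrite oppr_eq0 => /eqP h.
have := pairing_simple_root K A j j; rewrite (affine_diag affA) => pj.
have /eqP : pairing (pairing (bhat A J mu) (coroot j) *: simple_root K A j) (coroot j) = 0.
  by rewrite h /pairing mul0mx mxE.
by rewrite pairingZ pj mulf_eq0 pnatr_eq0 orbF => /eqP.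
Qed.

Lemma bhat_fixed mu : (forall j, j \in J -> pairing mu (coroot j) = 0) ->
  bhat A J mu = mu.
Proof.
move=> mu0; have fixed w : weyl A J w -> mu *m w = mu.
  elim=> [|j {}w jJ _ IH]; first exact: mulmx1.
  by rewrite mulmxA mul_reflection mu0 // scale0r subr0.
rewrite /bhat big_seq (eq_bigr (fun=> mu)) => [|w /mem_weyl_fset/fixed //].
by rewrite -big_seq big_const_seq count_predT iter_addr_0 -scaler_nat scalerA mulVf ?scale1r.
Qed.

Lemma bhat_root_comb mu (n : 'M[K]_l.+2 -> 'rV[rat]_l.+1) :
  (forall w, weyl A J w -> mu *m w = mu - root_comb (n w)) ->
  bhat A J mu = mu - root_comb ((#|` F|)%:R^-1 *: \sum_(w <- F) n w).
Proof.
move=> muw; rewrite root_combZ root_comb_sum fmorphV /= ratr_nat.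
rewrite /bhat big_seq (eq_bigr (fun w => mu - root_comb (n w))); last first.
  by move=> w /mem_weyl_fset/muw.
rewrite -big_seq sumrB scalerBr; congr (_ - _).
by rewrite big_const_seq count_predT iter_addr_0 -scaler_nat scalerA mulVf ?scale1r.
Qed.

Lemma bhat_convQ (T : set (weight K l)) mu :
  (forall w, weyl A J w -> convQ T (mu *m w)) -> convQ T (bhat A J mu).
Proof.
move=> muw.
have r0 : 0 <= (#|` F|)%:R^-1 :> rat by rewrite invr_ge0.
have sumT : coneQ T (#|` F|)%:R (\sum_(w <- F) mu *m w).
  by apply: coneQ_sum => w /mem_weyl_fset/muw.
have := coneQZ r0 sumT.
by rewrite mulVf ?pnatr_eq0 -?lt0n ?card_weyl_gt0 // fmorphV /= ratr_nat.
Qed.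

End Average.


(** * The dominant polyhedron in simple root coordinates *)

Section DominantPolyhedron.
Variables (K : numFieldType) (l : nat) (A : 'M[int]_l.+1).
Variables (d a : 'rV[rat]_l.+1).
Hypothesis affA : affine_cartan A d a.
Local Notation S := (symmetrized d A).
Local Notation root_comb := (@root_comb K l A).
Variables (lam : weight K l) (L : 'rV[rat]_l.+1).
Hypothesis lamL : has_values lam L.
Hypothesis L_gt0 : forall i, 0 < L 0 i.
Hypothesis lam_d : pairing lam scaling = 0.
Local Notation O := (weyl_orbit A lam).
Local Notation D := (dominant_polyhedron A lam).
Implicit Types (mu : weight K l) (J : {set 'I_l.+1}) (c : 'rV[rat]_l.+1).

Let d_gt0 := affine_sym_gt0 affA.
Let symS := affine_sym affA.
Let a_gt0 := affine_null_gt0 affA.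

Definition lowered c : weight K l := lam - root_comb c.
(** The values of [lowered c] on the simple coroots; their nonnegativity is dominance. *)
Definition slack c := L - coroot_values A c.

Lemma slackE c i : slack c 0 i = L 0 i - coroot_values A c 0 i.
Proof. by rewrite mxE [X in _ + X]mxE. Qed.

Lemma lowered_values c : has_values (lowered c) (slack c).
Proof. exact: has_valuesB. Qed.

Lemma slack_affine t c c' :
  slack (c + t *: (c' - c)) = (1 - t) *: slack c + t *: slack c'.
Proof.
rewrite /slack coroot_valuesD coroot_valuesZ coroot_valuesB.
move: (coroot_values A c) (coroot_values A c') => u v.
by apply/rowP=> i; rewrite !mxE; ring.
Qed.

Lemma values_rational mu m r : has_values mu m -> mu 0 ord_max = ratr r ->
  exists2 v : 'rV[rat]_l.+2, mu = map_mx ratr v & rational_weights mu.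
Proof.
move=> mum mur.
exists (\row_p if unlift ord_max p is Some i then m 0 i else r).
  apply/rowP=> p; rewrite !mxE; case: unliftP => [i|] ->; last exact: mur.
  by rewrite -pairingE mum.
exists (fun i => m 0 i), r; apply/rowP=> p.
rewrite mxE summxE; case: (unliftP ord_max p) => [i|] ->.
  rewrite -pairingE mum (bigD1 i) //= big1 => [|k ki]; rewrite !mxE.
    by rewrite !eqxx !mulr1 lift_eqF mulr0 !addr0.
  by rewrite (inj_eq lift_inj) eq_sym (negbTE ki) mulr0.
rewrite big1 => [|k _]; rewrite !mxE; last by rewrite eq_liftF mulr0.
by rewrite !eqxx mulr1 add0r mur.
Qed.

Lemma lowered_rational c :
  exists2 v : 'rV[rat]_l.+2, lowered c = map_mx ratr v &
    rational_weights (lowered c).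
Proof.
(* Among the simple roots only alpha_0 has a delta-coordinate, and that of lam is 0. *)
apply: (values_rational (r := - c 0 ord0) (lowered_values c)).
rewrite 2!mxE root_comb_ord_max rmorphN /=.
have <- : pairing lam scaling = lam 0 ord_max.
  rewrite /pairing mxE (bigD1 ord_max) //= mxE !eqxx mulr1 big1 ?addr0 //.
  by move=> j ji; rewrite mxE (negbTE ji) mulr0.
by rewrite lam_d add0r.
Qed.

Lemma lowered_mem c : (forall i, 0 <= slack c 0 i) -> convQ O (lowered c) ->
  D (lowered c).
Proof.
move=> c_dom; split=> //; split; first by case: (lowered_rational c).
by move=> i; rewrite lowered_values ler0q.
Qed.

Lemma orbit_mul v (w : 'M[K]_l.+2) : weyl A finset.setT w -> O v -> O (v *m w).
Proof.
move=> wW [w' w'W <-]; exists (w' *m w); first exact: weyl_mul.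
by rewrite mulmxA.
Qed.

(** Off-diagonal Cartan entries are nonpositive, so subtracting roots from J can only raise the
    values outside J. *)
Lemma slack_outside J c i : (forall i, 0 <= c 0 i) -> supported J c ->
  i \notin J -> L 0 i <= slack c 0 i.
Proof.
move=> c0 cJ iJ; rewrite slackE lerDl oppr_ge0 coroot_valuesE.
apply: sumr_le0 => j _; have [jJ|jJ] := boolP (j \in J); last by rewrite cJ // mulr0.
apply: mulr_le0_ge0 => //; rewrite lerz0 (affine_offdiag affA) //.
by apply: contraNneq iJ => ->.
Qed.

Lemma bhat_lowered J : J \proper 'I_l.+1 -> exists x : 'rV[rat]_l.+1,
  [/\ forall i, 0 <= x 0 i, supported J x, bhat A J lam = lowered x,
      forall j, j \in J -> slack x 0 j = 0 & convQ O (lowered x)].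
Proof.
move=> Jproper.
(* A displacement is chosen for every matrix; 0 is the default outside W_J. *)
have /choice[n nP] : forall w : 'M[K]_l.+2, exists n : 'rV[rat]_l.+1,
    weyl A J w -> [/\ forall i, 0 <= n 0 i, supported J n &
      lam *m w = lam - root_comb n].
  move=> w; have [wJ|nwJ] := pselect (weyl A J w); last by exists 0.
  have [n nE] := weyl_dominant_le affA lamL (fun i => ltW (L_gt0 i)) wJ.
  by exists n.
have bE := bhat_root_comb affA Jproper (fun w wJ => let: And3 _ _ h := nP w wJ in h).
set x := _ *: _ in bE; exists x; split.
- move=> i; rewrite mxE mulr_ge0 ?invr_ge0 // summxE big_seq sumr_ge0 // => w.
  by move=> /(mem_weyl_fset affA Jproper)/nP[].
- move=> i iJ; rewrite mxE summxE big_seq big1 ?mulr0 // => w.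
  by move=> /(mem_weyl_fset affA Jproper)/nP[_ ->].
- exact: bE.
- move=> j jJ; have := bhat_pairing affA Jproper lam jJ.
  by rewrite bE lowered_values => /eqP; rewrite fmorph_eq0 => /eqP.
rewrite -[lowered x]bE; apply: (bhat_convQ affA Jproper) => w wJ.
by apply: sub_convQ; exists w => //; apply: weyl_sub wJ; apply: finset.subsetT.
Qed.

Lemma lowered_affine t c c' :
  lowered (c + t *: (c' - c)) = ratr (1 - t) *: lowered c + ratr t *: lowered c'.
Proof.
rewrite /lowered root_combD root_combZ root_combB rmorphB rmorph1 /=.
move: (root_comb c) (root_comb c') (ratr t) => u v r.
by apply/rowP=> p; rewrite !mxE; ring.
Qed.

(* Induction on the size of J: the line from bhat_J through the given point
   leaves the cone below lam on a proper face. *)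
Lemma lowered_convQ J c : J \proper 'I_l.+1 -> (forall i, 0 <= c 0 i) ->
  supported J c -> (forall j, j \in J -> 0 <= slack c 0 j) ->
  convQ O (lowered c).
Proof.
have [s] := ubnP #|J|; elim: s J c => // s IH J c Js Jproper c0 cJ c_dom.
have [x [x0 xJ _ x_slack xO]] := bhat_lowered Jproper.
have [c_ge|] := pselect (forall j, x 0 j <= c 0 j).
  (* Here c - x >= 0 has nonpositive values on J, where x has slack 0; so its form is nonpositive,
     and definiteness on J forces c = x. *)
  suff /eqP : c - x = 0 by rewrite subr_eq0 => /eqP->.
  have cxJ : supported J (c - x) by move=> i iJ; rewrite !mxE cJ // xJ // subrr.
  apply/eqP/negPn/negP => /(bform_supported_gt0 affA Jproper cxJ).
  apply/negP; rewrite -leNgt bform_values; apply: sumr_le0 => i _.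
  have [iJ|iJ] := boolP (i \in J); last by rewrite cxJ // !mul0r.
  apply: mulr_ge0_le0.
    by rewrite mulr_ge0 ?(ltW (d_gt0 i)) // !mxE subr_ge0.
  have := c_dom i iJ; have := x_slack i iJ.
  rewrite !slackE => xL cL; rewrite coroot_valuesB mxE [X in _ + X]mxE.
  by lra.
move=> /existsNP[k0 /negP]; rewrite -ltNge => k0x.
(* The parameter at which coordinate k vanishes on the line from x through c. The least one is the
   first exit, and it is at least 1 since c >= 0. *)
pose ratio k := x 0 k / (x 0 k - c 0 k).
case: (arg_minP (P := fun k => c 0 k < x 0 k) ratio k0x) => k kx kmin.
set t := ratio k in kmin.
have t1 : 1 <= t by rewrite ler_pdivlMr ?subr_gt0 // mul1r gerBl.
have t_gt0 : 0 < t by apply: lt_le_trans t1.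
pose c' := x + t *: (c - x).
have kJ : k \in J by apply: contraLR kx => kJ; rewrite cJ // xJ // ltxx.
have c'O : convQ O (lowered c').
  apply: (IH (J :\ k)).
  - by move: Js; rewrite (cardsD1 k J) kJ.
  - exact: sub_proper_trans (subD1set _ _) Jproper.
  - move=> i; rewrite !mxE.
    have [xc|cx] := leP (x 0 i) (c 0 i).
      by rewrite addr_ge0 // mulr_ge0 ?subr_ge0 // ltW.
    have := kmin i cx; rewrite -/t ler_pdivlMr ?subr_gt0 // => h.
    by lra.
  - move=> i; rewrite !inE negb_and negbK => /orP[/eqP->|iJ]; last first.
      by rewrite !mxE cJ // xJ // subrr mulr0 addr0.
    rewrite !mxE /t /ratio -[c 0 k - x 0 k]opprB mulrN mulfVK ?subrr //.
    by rewrite subr_eq0 gt_eqF.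
  - move=> i; rewrite !inE => /andP[_ iJ].
    by rewrite slack_affine mxE [X in X + _]mxE [X in _ + X]mxE x_slack // mulr0 add0r mulr_ge0 ?c_dom // ltW.
(* Thus c lies between x and the exit point c', with weight 1/t on c'. *)
have cE : c = x + t^-1 *: (c' - x).
  by rewrite /c' addrAC subrr add0r scalerA mulVf ?gt_eqF // scale1r addrC subrK.
rewrite cE lowered_affine; apply: convQ_segment => //.
- by rewrite subr_ge0 invf_le1.
- by rewrite invr_ge0 ltW.
- by rewrite subrK.
Qed.

Lemma proper_setC1 (k : 'I_l.+1) : [set~ k]%SET \proper 'I_l.+1.
Proof.
apply/properP; split; first by apply/fintype.subsetP.
by exists k => //; rewrite !inE eqxx.
Qed.

Lemma slackD_null t c : slack (c + t *: a) = slack c.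
Proof.
by rewrite /slack coroot_valuesD coroot_valuesZ (affine_null affA) scaler0 addr0.
Qed.

(* The average over the finite Weyl group turns alpha_0 into delta. *)
Lemma bhat_simple_root0 :
  bhat A [set~ ord0]%SET (simple_root K A ord0) = root_comb a.
Proof.
set J := [set~ ord0]%SET; have Jproper : J \proper 'I_l.+1 := proper_setC1 ord0.
have rootv : has_values (simple_root K A ord0)
    (map_mx intr (\row_i A i ord0)).
  by move=> i; rewrite pairing_simple_root !mxE ratr_int.
have /choice[n nP] : forall w : 'M[K]_l.+2, exists n : 'rV[rat]_l.+1,
    weyl A J w -> supported J n /\
      simple_root K A ord0 *m w = simple_root K A ord0 - root_comb n.
  move=> w; have [wJ|nwJ] := pselect (weyl A J w); last by exists 0.
  have [n [nJ nE _]] := weyl_integral affA rootv wJ.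
  by exists (map_mx intr n).
have bE := bhat_root_comb affA Jproper (fun w wJ => proj2 (nP w wJ)).
rewrite -root_comb_delta -root_combB root_comb_delta in bE.
set x := _ - _ in bE.
(* Displacements under W_J are supported off 0, so averaging keeps the coefficient of alpha_0. *)
have x_0 : x 0 ord0 = 1.
  rewrite !mxE eqxx summxE big_seq big1 ?mulr0 ?subr0 // => w.
  by move=> /(mem_weyl_fset affA Jproper)/nP[-> //]; rewrite !inE eqxx.
have xv j : j != ord0 -> coroot_values A x 0 j = 0.
  move=> j0; have jJ : j \in J by rewrite !inE.
  have := bhat_pairing affA Jproper (simple_root K A ord0) jJ.
  by rewrite bE root_comb_values => /eqP; rewrite fmorph_eq0 => /eqP.
(* Since [a] is null, (a, x) = 0; only the term at 0 survives, with positive coefficient. *)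
have xv0 : coroot_values A x 0 ord0 = 0.
  have : bform S a x = 0.
    rewrite (bformC symS) bform_values (affine_null affA) big1 // => i _.
    by rewrite [X in _ * X]mxE mulr0.
  rewrite bform_values (bigD1 ord0) //= big1 ?addr0 => [|j j0]; last first.
    by rewrite xv // mulr0.
  by move=> /eqP; rewrite mulf_eq0 gt_eqF ?mulr_gt0 //= => /eqP.
have : bform S x x = 0.
  rewrite bform_values big1 // => i _.
  by have [->|i0] := eqVneq i ord0; rewrite ?xv0 ?xv // mulr0.
move=> /(affine_ker affA)[t xE]; rewrite bE xE; congr root_comb.
move: x_0; rewrite xE mxE (affine_null0 affA) mulr1 => ->.
by rewrite scale1r.
Qed.

(** Each round reflects by s_0, subtracting k alpha_0, and averages over W_{I - 0}, turning this
    into k delta. Moving along delta changes no coroot value, so every round subtracts the same k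
    delta while staying in the hull. *)
Lemma descending_ray : exists x k, 0 < k /\
  forall m : nat, D (lowered (x + (k * m%:R) *: a)).
Proof.
set J : {set 'I_l.+1} := [set~ ord0]%SET.
have Jproper : J \proper 'I_l.+1 := proper_setC1 ord0.
have [x [x0 xJ _ x_slack xO]] := bhat_lowered Jproper.
pose k := slack x 0 ord0.
have k0 : 0 < k.
  by apply: lt_le_trans (L_gt0 ord0) (slack_outside x0 xJ _); rewrite !inE eqxx.
exists x, k; split=> // m; apply: lowered_mem.
  move=> i; rewrite slackD_null; have [->|i0] := eqVneq i ord0; first exact: ltW.
  by rewrite x_slack // !inE.
elim: m => [|m IH]; first by rewrite mulr0 scale0r addr0.
set p := lowered _ in IH.
have pv i : pairing p (coroot i) = ratr (slack x 0 i).
  by rewrite lowered_values slackD_null.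
have -> : lowered (x + (k * m.+1%:R) *: a) =
    bhat A J (p *m simple_reflection K A ord0).
  rewrite mul_reflection bhatB bhatZ bhat_simple_root0 pv -/k.
  rewrite (bhat_fixed affA Jproper) => [|j jJ]; last by rewrite pv x_slack // rmorph0.
  rewrite /p /lowered -natr1 mulrDr mulr1 scalerDl addrA root_combD root_combZ.
  by rewrite opprD addrA.
apply: (bhat_convQ affA Jproper) => w wJ.
have wT : weyl A finset.setT w by apply: weyl_sub wJ; apply: finset.subsetT.
have sT : weyl (K := K) A finset.setT (simple_reflection K A ord0).
  by rewrite -[simple_reflection _ _ _]mulmx1; apply: WeylM (Weyl1 _ _ _); rewrite inE.
by do 2![apply: convQ_mulmx => [v|]; first exact: orbit_mul].
Qed.

(** Each orbit point is lam minus a nonnegative combination of simple roots, and weights of sum 1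
    preserve this form. *)
Lemma polyhedron_lowered mu : D mu -> exists c,
  [/\ forall i, 0 <= c 0 i, forall i, 0 <= slack c 0 i & mu = lowered c].
Proof.
move=> [[_ mu_dom] [n [q [v [q0 q1 vO muE]]]]].
have /choice[c cP] : forall k, exists c : 'rV[rat]_l.+1,
    (forall i, 0 <= c 0 i) /\ v k = lowered c.
  move=> k; have [w wW <-] := vO k.
  have [c [c0 _ cE]] := weyl_dominant_le affA lamL (fun i => ltW (L_gt0 i)) wW.
  by exists c.
have muc : mu = lowered (\sum_k q k *: c k).
  rewrite muE /lowered root_comb_sum.
  under [in RHS]eq_bigr => k _ do rewrite root_combZ.
  rewrite -[lam in RHS]scale1r -(rmorph1 (@ratr K)) -q1 rmorph_sum scaler_suml -sumrB.
  by apply: eq_bigr => k _; rewrite (cP k).2 scalerBr.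
exists (\sum_k q k *: c k); split=> // i.
  by rewrite summxE sumr_ge0 // => k _; rewrite mxE mulr_ge0 // (cP k).1.
by have := mu_dom i; rewrite muc lowered_values ler0q.
Qed.

End DominantPolyhedron.


(** * Vertices: proper and full support *)

Lemma exists_pos_lower_bound (I : finType) (F : I -> rat) :
  (forall i, 0 < F i) -> exists2 e, 0 < e & forall i, e <= F i.
Proof.
move=> F0; have [i0|noI] := pickP I; last by exists 1 => // i; have := noI i.
by case: (arg_minP F (P := predT) (i0 := i0)) => // i _ imin; exists (F i) => // j; apply: imin.
Qed.

Section Vertices.
Variables (K : numFieldType) (l : nat) (A : 'M[int]_l.+1).
Variables (d a : 'rV[rat]_l.+1).
Hypothesis affA : affine_cartan A d a.
Local Notation root_comb := (@root_comb K l A).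
Variables (lam : weight K l) (L : 'rV[rat]_l.+1).
Hypothesis lamL : has_values lam L.
Hypothesis L_gt0 : forall i, 0 < L 0 i.
Hypothesis lam_d : pairing lam scaling = 0.
Local Notation D := (dominant_polyhedron A lam).
Local Notation lowered := (lowered A lam).
Local Notation slack := (slack A L).
Implicit Types c : 'rV[rat]_l.+1.
Let a_gt0 := affine_null_gt0 affA.

(** The segment from bhat_J(lam) to the vertex extends a little inside D, so the functional defining
    the vertex is also maximal at bhat_J(lam). *)
Lemma vertex_bhat_support c : (forall i, 0 <= c 0 i) ->
  (forall i, 0 <= slack c 0 i) -> vertices D (lowered c) ->
  [set i | 0 < c 0 i]%SET \proper 'I_l.+1 ->
  lowered c = bhat A [set i | 0 < c 0 i]%SET lam.
Proof.
set J := [set i | 0 < c 0 i]%SET => c0 c_dom [h [r [hle hE]]] Jproper.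
have [x [x0 xJ -> x_slack xO]] := bhat_lowered affA lamL L_gt0 Jproper.
have cJ : supported J c.
  by move=> i; rewrite inE -leNgt => ci; apply/le_anti; rewrite ci c0.
have xD : D (lowered x).
  apply: lowered_mem => // i; have [iJ|iJ] := boolP (i \in J); first by rewrite x_slack.
  by apply: le_trans _ (slack_outside affA L x0 xJ iJ); apply: ltW.
have [e e0 ec] : exists2 e, 0 < e & forall i, i \in J -> e * x 0 i <= c 0 i.
  (* The added 1 keeps the denominator positive when x_i = 0. *)
  pose F i := if i \in J then c 0 i / (x 0 i + 1) else 1.
  have [i|e e0 eF] := @exists_pos_lower_bound _ F.
    rewrite /F; case: ifP => //; rewrite inE => ci.
    by rewrite divr_gt0 // ltr_wpDl.
  exists e => // i iJ; have := eF i; rewrite /F iJ ler_pdivlMr ?ltr_wpDl //.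
  by rewrite mulrDr mulr1; lra.
(* Coordinates are (1 + e) c_i - e x_i, nonnegative by the choice of e. *)
pose c' := x + (1 + e) *: (c - x).
have c'0 i : 0 <= c' 0 i.
  rewrite !mxE; have [iJ|iJ] := boolP (i \in J); last first.
    by rewrite cJ // xJ // subrr mulr0 addr0.
  by have := ec i iJ; have := c0 i; nra.
have c'J : supported J c' by move=> i iJ; rewrite !mxE cJ // xJ // subrr mulr0 addr0.
have c'_dom i : i \in J -> 0 <= slack c' 0 i.
  move=> iJ; rewrite slack_affine mxE [X in X + _]mxE [X in _ + X]mxE x_slack //.
  by rewrite mulr0 add0r mulr_ge0 // addr_ge0 // ltW.
have c'D : D (lowered c').
  apply: lowered_mem => // [i|]; last exact: (lowered_convQ affA lamL L_gt0 Jproper).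
  have [/c'_dom //|iJ] := boolP (i \in J).
  by apply: le_trans _ (slack_outside affA L c'0 c'J iJ); apply: ltW.
have [_ /= hc] : (D `&` [set mu | pairing mu (map_mx ratr h) = ratr r]) (lowered c).
  by rewrite -hE.
suff : [set lowered c] (lowered x) by [].
rewrite hE; split=> //=; apply/le_anti; rewrite hle //=.
(* At c' the functional is (1 + e) times its maximum minus e times its value at x; validity there
   makes the value at x at least the maximum. *)
have := hle _ c'D; rewrite lowered_affine pairingD !pairingZ hc rmorphB rmorphD /= rmorph1.
have e0K : 0 < ratr e :> K by rewrite ltr0q.
move=> h1; rewrite -(ler_pM2l e0K).
rewrite -subr_ge0 in h1; rewrite -subr_ge0; apply: le_trans h1 _.
by rewrite le_eqVlt; apply/orP; left; apply/eqP; ring.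
Qed.

Lemma vertex_not_interior c : (forall i, 0 < c 0 i) ->
  (forall i, 0 <= slack c 0 i) -> ~ vertices D (lowered c).
Proof.
move=> c0 c_dom [h [r [hle hE]]].
(* The largest multiple s of delta with c - s a >= 0; coordinate k then vanishes, so [lowered_convQ]
   applies off k. *)
case: (arg_minP (fun i => c 0 i / a 0 i) (P := predT) (i0 := ord0)) => // k _ kmin.
set s := c 0 k / a 0 k.
have s0 : 0 < s by rewrite divr_gt0.
have sD : D (lowered (c + (- s) *: a)).
  have dom i : 0 <= slack (c + (- s) *: a) 0 i by rewrite (slackD_null affA).
  apply: lowered_mem => //.
  apply: (lowered_convQ affA lamL L_gt0 (proper_setC1 k)) => //.
    move=> i; rewrite !mxE mulNr subr_ge0 -ler_pdivlMr //.
    exact: kmin.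
  move=> i; rewrite !inE negbK => /eqP->.
  by rewrite !mxE mulNr mulfVK ?subrr // gt_eqF.
have [_ /= hc] : (D `&` [set mu | pairing mu (map_mx ratr h) = ratr r]) (lowered c).
  by rewrite -hE.
have shift x t : lowered (x + t *: a) = lowered x - ratr t *: root_comb a.
  by rewrite /lowered root_combD root_combZ opprD addrA.
have [v vE _] : exists2 v : 'rV[rat]_l.+2, root_comb a = map_mx ratr v &
    rational_weights (root_comb a).
  exact: values_rational (root_comb_values K A a) (root_comb_ord_max K A a).
have pairq (u : 'rV[rat]_l.+2) : pairing (map_mx ratr u : weight K l) (map_mx ratr h)
    = ratr ((u *m h) 0 0).
  by rewrite /pairing -map_mxM mxE.
set q := (v *m h) 0 0.
have qE : pairing (root_comb a) (map_mx ratr h) = ratr q by rewrite vE pairq.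
(* Validity at the point shifted by s delta gives q <= 0. If q were 0, this point, which differs in
   its delta-coordinate, would lie in the face too. *)
have q0 : q < 0.
  rewrite lt_neqAle; apply/andP; split.
    apply/eqP => q0; have : [set lowered c] (lowered (c + (- s) *: a)).
      by rewrite hE; split=> //=; rewrite shift pairingB pairingZ qE q0 rmorph0 mulr0 subr0.
    rewrite /= shift => /rowP/(_ ord_max)/eqP.
    rewrite mxE [X in _ + X]mxE [X in - X]mxE root_comb_ord_max (affine_null0 affA).
    rewrite -subr_eq0 addrAC subrr add0r oppr_eq0 rmorph1 mulr1 fmorph_eq0.
    by rewrite oppr_eq0 gt_eqF.
  have := hle _ sD; rewrite shift pairingB pairingZ qE hc rmorphN /= mulNr opprK.
  by rewrite gerDl -rmorphM /= lerq0 pmulr_rle0.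
have [x [k' [k'0 ray]]] := descending_ray affA lamL L_gt0 lam_d.
have [u uE _] := lowered_rational A lamL lam_d x.
set p := (u *m h) 0 0.
have bound (m : nat) : p - k' * m%:R * q <= r.
  have := hle _ (ray m); rewrite shift pairingB pairingZ qE uE pairq -rmorphM -rmorphB /=.
  by rewrite ler_rat.
(* The bound is affine in m with positive slope -k' q, so it fails once m exceeds (r - p) / (-k'
   q). *)
have kq : 0 < - (k' * q) by rewrite oppr_gt0 pmulr_rlt0.
pose y := (r - p) / - (k' * q).
have /(le_lt_trans (ler_norm y)) := archi_boundP (normr_ge0 y).
have := bound (Num.bound `|y|); move: (Num.bound _)%:R => N.
rewrite /y ltr_pdivrMr // => h1 h2; have : r - p < r - p.
  apply: lt_le_trans h2 _; rewrite lerBrDl; apply: le_trans h1.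
  by rewrite le_eqVlt; apply/orP; left; apply/eqP; ring.
by rewrite ltxx.
Qed.


End Vertices.

Theorem proposition3p9 (R : realType) (l : nat) (A : 'M[int]_l.+1)
    (hA : untwisted_affine A) (lam : weight R[i] l)
    (lam_int : integral_dominant lam) (lam_reg : regular_dominant lam)
    (lam_d : pairing lam scaling = 0) :
  vertices (dominant_polyhedron A lam) `<=`
    [set bhat A J lam | J in [set J : {set 'I_l.+1} | J \proper 'I_l.+1]].
Proof.
have [d [a affA]] := untwisted_affine_cartan hA.
have [n nE] := choice lam_int.
pose L : 'rV[rat]_l.+1 := \row_i (n i)%:R.
have lamL : has_values lam L by move=> i; rewrite nE mxE ratr_nat.
have L_gt0 i : 0 < L 0 i by have := lam_reg i; rewrite lamL ltr0q.
move=> mu mu_vertex.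
have muD : dominant_polyhedron A lam mu.
  have [h [r [_ hE]]] := mu_vertex.
  by have [] : (dominant_polyhedron A lam `&`
    [set nu | pairing nu (map_mx ratr h) = ratr r]) mu by rewrite -hE.
have [c [c0 c_dom muE]] := polyhedron_lowered affA lamL L_gt0 muD.
rewrite muE in mu_vertex *.
(* The support of c is either all of I, which a vertex excludes, or the required proper subset J. *)
have [c_gt0|] := pselect (forall i, 0 < c 0 i).
  by case: (vertex_not_interior affA lamL L_gt0 lam_d c_gt0 c_dom).
move=> /existsNP[k /negP ck].
have Jproper : [set i | 0 < c 0 i]%SET \proper 'I_l.+1.
  apply/properP; split; first exact/fintype.subsetP.
  by exists k => //; rewrite inE.
exists [set i | 0 < c 0 i]%SET => //.
by rewrite (vertex_bhat_support affA lamL L_gt0 lam_d c0 c_dom mu_vertex Jproper).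
Qed.
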